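(* Let $\beta\in(0,1)$ and $p\ge1$, and assume additionally that $p\ne d/2$. Let $\bar p:=\max\{2p,d\}$ and $$\bar C\equiv\bar C(\bar p,\beta,\rho_T):=\Big(\frac{\ln(C\beta^{-1})}{c}\Big)^{1/\bar p}\rho_T,\qquad \rho_T:=\tfrac12\operatorname{diam}(\Phi_T(K)).$$ For $\Delta>0$ and $N\in\mathbb N=\{1,2,\dots\}$ let $$\bar\varepsilon_N(\Delta):=\mathfrak K\Big(\frac1N\int_1^N(e^{L\Delta s}-1)^p\,ds\Big)^{1/p},\qquad \psi_N(\beta,\Delta):=\varepsilon_N(\beta,\rho_T)+\bar\varepsilon_N(\Delta).$$ Then there exists $\Delta^*\equiv\Delta^*(\bar C,L,\mathfrak K)>0$ such that for every $\Delta\in(0,\Delta^* )$ the set $$\mathcal N(\Delta):=\big\{N\in\mathbb N\,\big|\,\bar C\big(\kappa^{-1/\bar p}-(\kappa+1)^{-1/\bar p}\big)>\bar\varepsilon_{\kappa+1}(\Delta)-\bar\varepsilon_\kappa(\Delta),\ \forall\kappa\in\{1,\dots,N\}\big\}$$ is nonempty and bounded. In addition, the ambiguity radius $\psi_N(\beta,\Delta)$ is strictly decreasing with $N$, for $N\in\{1,\dots,N^*(\Delta)\}$, with $N^*(\Delta):=\max(\mathcal N(\Delta))+1$.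
   Context: Setting: $\dot\xi_t=F(t,\xi_t)$ on $\mathbb{R}^d$ with $F$ continuous and locally Lipschitz in $\xi$, and the system forward complete; $\Phi_{t,s}(\xi)$ ($t\ge s\ge0$) is the value at time $t$ of the solution equal to $\xi$ at time $s$, and $\Phi_t:=\Phi_{t,0}$. The support of the (random) initial condition is contained in the compact set $K\subset\mathbb{R}^d$, and $[0,T]$ is the horizon. $\operatorname{diam}(S):=\sup\{\|x-y\|_\infty:x,y\in S\}$. Sampling: there are $\bar N$ independent trajectories $\xi^1,\dots,\xi^{\bar N}$ with i.i.d. initial conditions, and one full-state sample $\xi^i_{t_i}$ is collected from trajectory $i$ at time $t_i$, with $0\le t_1\le\dots\le t_{\bar N}=T$ and $t_i-t_{i-1}\le\Delta$ for $i\in\{2,\dots,\bar N\}$; $\Delta>0$ is called an inter-trajectory sampling-time bound. The last $N=\bar N-N^\flat+1$ trajectories, with indices $N^\flat,\dots,\bar N$, are used to form $\bar P^N_{\xi_T}:=\frac1N\sum_{i=N^\flat}^{\bar N}\delta_{\bar\xi^i_T}$, $\bar\xi^i_T:=\Phi^{\mathrm{num}}_{T,t_i}(\xi^i_{t_i})$, where $\Phi^{\mathrm{num}}$ is a numerical approximation of the flow and $\mathfrak K,L>0$ are constants such that $\|\Phi^{\mathrm{num}}_{t,s}(\xi)-\Phi_{t,s}(\xi)\|\le\mathfrak K(e^{L(t-s)}-1)$ for all $0\le s\le t\le T$ and $\xi\in\Phi_s(K)$. The quantity $\psi_N(\beta,\Delta)$ is the ambiguity radius of the $p$-Wasserstein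 ball centered at $\bar P^N_{\xi_T}$. Constants and nominal radius: $C$ and $c$ are constants, depending only on $p$ and $d$, of the following concentration inequality: for every sequence $(X_i)$ of i.i.d. $\mathbb{R}^d$-valued random variables with compactly supported law $\mu$, with $\rho:=\frac12\operatorname{diam}(\operatorname{supp}\mu)$ and $\widehat\mu^N:=\frac1N\sum_{i=1}^N\delta_{X_i}$, and all $N\ge1$, $\varepsilon>0$, one has $\mathbb P(W_p^p(\widehat\mu^N,\mu)\ge\varepsilon)\le Ce^{-cN\varepsilon^2/\rho^{2p}}$ if $p>d/2$, and $\le Ce^{-cN\varepsilon^{d/p}/\rho^d}$ if $p<d/2$ ($W_p$ is the $p$-Wasserstein distance with Euclidean cost). For $p\ne d/2$, $$\varepsilon_N(\beta,\rho):=\begin{cases}\left(\frac{\ln(C\beta^{-1})}{c}\right)^{\frac1{2p}}\frac{\rho}{N^{1/(2p)}}, & p>d/2,\\ \left(\frac{\ln(C\beta^{-1})}{c}\right)^{\frac1d}\frac{\rho}{N^{1/d}}, & p<d/2.\end{cases}$$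
   Formalization: The assumption ρ_T > 0 (K has at least two points) is added: if K is a single point then C̄ = 0 and N(Δ) is empty for every Δ > 0, so the claim fails. The constant c is taken positive. *)

(* Defs.v *)
From HB Require Import structures.
From mathcomp Require Import all_boot all_order all_algebra.
From mathcomp Require Import all_classical all_reals all_analysis.
Set Implicit Arguments.
Unset Strict Implicit.
Unset Printing Implicit Defensive.
Import Order.TTheory GRing.Theory Num.Theory numFieldNormedType.Exports.
Local Open Scope classical_set_scope.
Local Open Scope ring_scope.

(* The library norm `|x| on 'rV[R]_d is the max norm; the unadorned norm of the
   mathematics is the Euclidean one, defined here. *)
Definition enorm (R : realType) (d : nat) (x : 'rV[R]_d) : R :=
  Num.sqrt (\sum_(i < d) x ord0 i ^+ 2).

(* Diameter for the max norm.  [sup] is the genuine supremum on nonempty bounded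
   sets and 0 otherwise. *)
Definition diam (R : realType) (d : nat) (S : set 'rV[R]_d) : R :=
  sup [set r | exists x y : 'rV[R]_d, [/\ S x, S y & r = `|x - y|]].

Section dynamics.
Context {R : realType} {d : nat}.
Implicit Types (F : R -> 'rV[R]_d -> 'rV[R]_d).

(* Only the values of F at times t >= 0 matter: F is a vector field on
   [0, +oo) x R^d. *)
Definition continuous_field F : Prop :=
  {within [set z : R * 'rV[R]_d | 0 <= z.1], continuous (fun z => F z.1 z.2)}.

Definition locally_lipschitz_field F : Prop :=
  forall (t : R) (x : 'rV[R]_d), 0 <= t ->
  exists (r k : R), 0 < r /\
    forall (s : R) (y z : 'rV[R]_d), 0 <= s -> `|s - t| < r ->
      enorm (y - x) < r -> enorm (z - x) < r ->
      enorm (F s y - F s z) <= k * enorm (y - z).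

(* Since F is continuous, continuity of y at the initial time s together with
   the equation on ]s, +oo[ gives the equation at s for the right derivative. *)
Definition solves F (s : R) (x : 'rV[R]_d) (y : R -> 'rV[R]_d) : Prop :=
  [/\ y s = x,
      {within [set t : R | s <= t], continuous y} &
      forall t : R, s < t -> is_derive t 1 y (F t (y t))].

Definition forward_complete F : Prop :=
  forall (s : R) (x : 'rV[R]_d), 0 <= s -> exists y, solves F s x y.

(* The value at time t of the solution equal to x at time s.  Under
   [forward_complete] and [locally_lipschitz_field] this solution exists and is
   unique on [s, +oo), so that the choice made by [xget] is immaterial for
   t >= s >= 0. *)
Definition flow F (t s : R) (x : 'rV[R]_d) : 'rV[R]_d :=
  xget (fun=> 0) [set y | solves F s x y] t.

End dynamics.

(* R^d with its Borel sigma-algebra. *)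
Definition borelRd (R : realType) (d : nat) :=
  g_sigma_algebraType (@open 'rV[R]_d).

Section measures.
Context {R : realType} {d : nat}.
Notation E := (borelRd R d).

Definition msupport (mu : set E -> \bar R) : set 'rV[R]_d :=
  [set x : 'rV[R]_d |
    forall U : set 'rV[R]_d, open U -> U x -> (0 < mu U)%E].

Definition coupling (mu nu : set E -> \bar R) (pi : set (E * E) -> \bar R)
    : Prop :=
  forall A : set E, measurable A ->
    pi (A `*` setT) = mu A /\ pi (setT `*` A) = nu A.

(* p-Wasserstein distance with Euclidean cost, as an extended real. *)
Definition wasserstein (p : R) (mu nu : set E -> \bar R) : \bar R :=
  (poweR (ereal_inf
    [set (\int[pi]_z ((enorm ((z.1 : 'rV[R]_d) - (z.2 : 'rV[R]_d)) `^ p)%:E))%E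
      | pi in [set pi : probability (E * E)%type R | coupling mu nu pi]])
    p^-1).

End measures.

Section sampling.
Context {disp : measure_display} {T : measurableType disp} {R : realType}
  {d : nat}.
Variable P : probability T R.
Implicit Types X : nat -> {RV P >-> borelRd R d}.

Definition iid X : Prop :=
  (forall (s : seq nat) (A : nat -> set (borelRd R d)),
    uniq s -> (forall i, measurable (A i)) ->
    P (\bigcap_(i in [set` s]) (X i @^-1` A i)) =
      (\prod_(i <- s) P (X i @^-1` A i))%E) /\
  (forall (i j : nat) (A : set (borelRd R d)), measurable A ->
    P (X i @^-1` A) = P (X j @^-1` A)).

(* The random variables X_1, ..., X_N of the mathematics are X 0, ..., X N.-1. *)
Definition empirical X (N : nat) (w : T) : set (borelRd R d) -> \bar R :=
  fun A => ((N%:R^-1)%:E * \sum_(i < N) \d_(X i w) A)%E.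

End sampling.

(* C and c are uniform in the law, the sequence, N and eps.  For a Dirac law,
   rho = 0 and the quotients by powers of rho are 0 by convention; the event is
   then negligible, so that the requirement reads 0 <= C, which already follows
   from the nondegenerate laws. *)
Definition concentration_constants (R : realType) (d : nat) (p C c : R) : Prop :=
  forall (disp : measure_display) (T : measurableType disp)
    (P : probability T R) (X : nat -> {RV P >-> borelRd R d}),
  let mu : set (borelRd R d) -> \bar R := distribution P (X 0%N) in
  let rho := diam (msupport mu) / 2 in
  iid X -> compact (msupport mu) ->
  forall (N : nat) (eps : R), (0 < N)%N -> 0 < eps ->
  let prob :=
    P [set w | (eps%:E <= poweR (wasserstein p (empirical X N w) mu) p)%E] in
  (d%:R / 2 < p ->
    (prob <= (C * expR (- (c * N%:R * eps ^+ 2 / rho `^ (2 * p))))%:E)%E) /\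
  (p < d%:R / 2 ->
    (prob <= (C * expR (- (c * N%:R * eps `^ (d%:R / p) / rho ^+ d)))%:E)%E).

Section radius.
Context {R : realType}.

(* Meant for p != d / 2, so that the second branch is p < d / 2. *)
Definition nominal_radius (d : nat) (p C c beta rho : R) (N : nat) : R :=
  if d%:R / 2 < p then
    (ln (C * beta^-1) / c) `^ (1 / (2 * p)) * (rho / N%:R `^ (1 / (2 * p)))
  else
    (ln (C * beta^-1) / c) `^ (1 / d%:R) * (rho / N%:R `^ (1 / d%:R)).

Definition epsbar (p Kf L Delta : R) (N : nat) : R :=
  Kf * (N%:R^-1 *
    \int[lebesgue_measure]_(s in `[1, N%:R]) (expR (L * Delta * s) - 1) `^ p)
      `^ (1 / p).

Definition psi (d : nat) (p C c beta rho Kf L Delta : R) (N : nat) : R :=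
  nominal_radius d p C c beta rho N + epsbar p Kf L Delta N.

Definition Nset (p pbar Cbar Kf L Delta : R) : set nat :=
  [set N | (0 < N)%N /\ forall k : nat, (1 <= k <= N)%N ->
    Cbar * (k%:R `^ (- (1 / pbar)) - k.+1%:R `^ (- (1 / pbar))) >
      epsbar p Kf L Delta k.+1 - epsbar p Kf L Delta k].

End radius.

(* The maximum of a nonempty bounded set of naturals (0 if there is none). *)
Definition nat_max (A : set nat) : nat :=
  xget 0%N [set m | A m /\ forall n, A n -> (n <= m)%N].

(* Main.v *)
Require Import Defs.
From HB Require Import structures.
From mathcomp Require Import all_boot all_order all_algebra.
From mathcomp Require Import all_classical all_reals all_analysis.
From mathcomp Require Import measurable_realfun.
Import Order.TTheory GRing.Theory Num.Theory numFieldNormedType.Exports.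
Local Open Scope classical_set_scope.
Local Open Scope ring_scope.
Set Implicit Arguments.
Unset Strict Implicit.
Unset Printing Implicit Defensive.

(** Let q = 1 / pbar.  Since p <> d / 2, the nominal radius is exactly
    Cbar * N^-q, so the inequality defining the admissible indices k says
    literally that psi k.+1 < psi k; the monotonicity claim follows by chaining
    these inequalities up to the largest admissible horizon.  What remains is
    that the admissible set is nonempty for small Delta and always bounded.

    Nonempty ([Nset1]): epsbar vanishes at N = 1, and at N = 2 it is at most
    Kf * (e^(2 L Delta) - 1), because the integrand increases.  Requiring this
    to be below the gap Cbar * (1 - 2^-q) is solved explicitly for Delta:
      Dstar = ln (1 + Cbar * (1 - 2^-q) / Kf) / (2 L).

    Bounded ([Nset_bounded]): if all indices up to N were admissible,
    telescoping would give epsbar N <= Cbar * (1 - N^-q) < Cbar, whereas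
    keeping only the upper half of the integral shows that epsbar (2 m) is at
    least Kf * L * Delta * m / 2, which is unbounded in m
    ([epsbar_double_ge]).

    All of this needs Cbar > 0, hence ln (C / beta) > 0, and the only
    information about C is that it works in the concentration inequality.
    Testing that inequality on one suitable law yields C >= 1
    ([concentration_constants_ge1]).  Take i.i.d. fair coin tosses between the
    origin and the all-ones vector e, and a single sample.  The empirical
    measure is then a Dirac mass at one of the two points, and half of the mass
    of the law sits at the other one, at Euclidean distance sqrt d >= 1.  Hence
    W_p^p >= 1/2 surely, and the inequality with eps = 1/2 reads
    1 <= C * exp (- u) for some u >= 0.  An infinite sequence of independent
    tosses is realized by the binary digits of a uniform point of [0, 1]. *)

(** * Integrals of nondecreasing functions *)

Section MonotoneIntegral.
Context {R : realType}.
Context (f : R -> R) (f_ge0 : forall s, 0 <= f s) (mf : measurable_fun setT f)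
  (f_homo : {in Num.nneg &, {homo f : s t / s <= t}}).
Notation mu := (@lebesgue_measure R).

Lemma integrable_homo (x y : R) : 0 <= x ->
  mu.-integrable `[x, y] (EFin \o f).
Proof.
move=> x0; apply: measurable_bounded_integrable => //.
- by rewrite /= lebesgue_measure_itv/=; case: ifP => // _; rewrite -EFinB ltry.
- exact: (measurable_funS measurableT).
- exists (f y); split; first exact: num_real.
  move=> M yM s /=; rewrite in_itv/= => /andP[xs sy].
  rewrite ger0_norm ?f_ge0// (le_trans _ (ltW yM))//.
  have s0 := le_trans x0 xs.
  by apply: f_homo; rewrite ?nnegrE// (le_trans s0).
Qed.

(** The part of the integral over [y, z] alone already exceeds the bound. *)
Lemma Rintegral_homo_ge (x y z : R) : 0 <= x -> x <= y -> y <= z ->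
  (z - y) * f y <= \int[mu]_(s in `[x, z]) f s.
Proof.
move=> x0 xy yz; have y0 := le_trans x0 xy.
rewrite /Rintegral -[leLHS]/(fine ((z - y) * f y)%:E).
apply: fine_le => //.
  by apply: integrable_fin_num => //; exact: integrable_homo.
apply: (@le_trans _ _ (\int[mu]_(s in `[y, z]) (f s)%:E)%E); last first.
  apply: ge0_subset_integral => //.
  - by apply/measurable_EFinP; exact: (measurable_funS measurableT).
  - by move=> s _; rewrite lee_fin f_ge0.
  - by move=> s /=; rewrite !in_itv/= => /andP[/(le_trans xy)-> ->].
apply: (@le_trans _ _ (\int[mu]_(s in `[y, z]) (f y)%:E)%E).
  rewrite integral_cst//= lebesgue_measure_itv/=; case: ifPn.
    by rewrite -EFinB -EFinM mulrC.
  rewrite lte_fin -leNgt => zy; have -> : z = y by apply/eqP; rewrite eq_le zy.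
  by rewrite subrr mul0r mule0.
apply: ge0_le_integral => //.
- by move=> s _; rewrite lee_fin f_ge0.
- by apply/measurable_EFinP; exact: (measurable_funS measurableT).
- move=> s /=; rewrite in_itv/= => /andP[ys _]; rewrite lee_fin.
  by apply: f_homo; rewrite ?nnegrE// (le_trans y0).
Qed.

Lemma Rintegral_homo_le (x y : R) : 0 <= x -> x <= y ->
  \int[mu]_(s in `[x, y]) f s <= (y - x) * f y.
Proof.
move=> x0 xy; have y0 := le_trans x0 xy.
have -> : (y - x) * f y = \int[mu]_(s in `[x, y]) f y.
  rewrite Rintegral_cst//= lebesgue_measure_itv/=; case: ifPn.
    by rewrite mulrC.
  rewrite lte_fin -leNgt => yx; have -> : x = y by apply/eqP; rewrite eq_le xy.
  by rewrite subrr mul0r mulr0.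
apply: le_Rintegral => //.
- exact: integrable_homo.
- apply: measurable_bounded_integrable => //.
    by rewrite /= lebesgue_measure_itv/=; case: ifP => // _; rewrite -EFinB ltry.
  exists (f y); split; first exact: num_real.
  by move=> M yM s _ /=; rewrite ger0_norm ?f_ge0// ltW.
- move=> s /=; rewrite in_itv/= => /andP[xs sy].
  by apply: f_homo; rewrite ?nnegrE// (le_trans x0).
Qed.

End MonotoneIntegral.

(** * Growth of the numerical error *)

Section Growth.
Context {R : realType}.
Implicit Types (p a L D Kf : R).
Notation mu := (@lebesgue_measure R).

(** The integrand of [epsbar], with a = L * Delta. *)
Definition growth p a (s : R) : R := (expR (a * s) - 1) `^ p.

Lemma growth_ge0 p a s : 0 <= growth p a s.
Proof. exact: powR_ge0. Qed.

Lemma growth_homo p a : 0 <= p -> 0 <= a ->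
  {in Num.nneg &, {homo growth p a : s t / s <= t}}.
Proof.
move=> p0 a0 s t; rewrite !nnegrE => s0 t0 st.
have base (u : R) : 0 <= u -> expR (a * u) - 1 \in Num.nneg.
  by move=> u0; rewrite nnegrE subr_ge0 -[leLHS]expR0 ler_expR mulr_ge0.
apply: ge0_ler_powR => //; try exact: base.
by rewrite lerB// ler_expR ler_wpM2l.
Qed.

Lemma measurable_growth p a : measurable_fun setT (growth p a).
Proof.
apply: (measurableT_comp (measurable_powR p)).
apply: measurable_funB => //.
by apply: (measurableT_comp (@measurable_expR R)); exact: measurable_funM.
Qed.

Lemma powR_root p (x : R) : 0 < p -> 0 <= x -> (x `^ p) `^ (1 / p) = x.
Proof.
by move=> p0 x0; rewrite -powRrM mul1r mulfV ?lt0r_neq0// powRr1.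
Qed.

Lemma epsbar1 p Kf L D : p != 0 -> epsbar p Kf L D 1 = 0.
Proof.
move=> p0; rewrite /epsbar set_itv1 Rintegral_set1 mulr0 powR0 ?mulr0//.
by rewrite mulf_neq0// invr_eq0.
Qed.

(** The prefactor 1/2 of the mean is simply bounded by 1: this loses a constant
    but gives a bound that can be inverted explicitly in D. *)
Lemma epsbar2_le p Kf L D : 1 <= p -> 0 <= Kf -> 0 <= L * D ->
  epsbar p Kf L D 2 <= Kf * (expR (L * D * 2) - 1).
Proof.
move=> p1 K0 LD0; have p0 : 0 < p by exact: lt_le_trans p1.
have e0 : 0 <= expR (L * D * 2) - 1.
  by rewrite subr_ge0 -[leLHS]expR0 ler_expR mulr_ge0.
rewrite ler_wpM2l//.
rewrite -[leRHS](powR_root p0 e0).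
rewrite ge0_ler_powR ?divr_ge0 ?(ltW p0)// ?nnegrE ?powR_ge0//.
  by rewrite mulr_ge0 ?Rintegral_ge0// => s _; exact: growth_ge0.
have := @Rintegral_homo_le _ _ (growth_ge0 p (L * D))
  (measurable_growth p (L * D)) (growth_homo (ltW p0) LD0) 1 2 ler01.
rewrite /growth => /(_ (ler1n _ 2)).
rewrite -[X in X - 1]/(1 + 1 : R) addrK mul1r => h.
apply: le_trans h; rewrite ler_piMl ?invf_le1// ?ler1n//.
by rewrite Rintegral_ge0// => s _; exact: growth_ge0.
Qed.

(** On [m, 2 m] the integrand is at least (L * D * m)^p, by e^x - 1 >= x; this
    interval carries half of the mean, and (1/2)^(1/p) >= 1/2. *)
Lemma epsbar_double_ge p Kf L D (m : nat) : 1 <= p -> 0 <= Kf -> 0 <= L * D ->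
  (0 < m)%N -> Kf * (L * D * m%:R / 2) <= epsbar p Kf L D m.*2.
Proof.
move=> p1 K0 LD0 m0; have p0 : 0 < p by exact: lt_le_trans p1.
have m0R : 0 < m%:R :> R by rewrite ltr0n.
have b0 : 0 <= L * D * m%:R by rewrite mulr_ge0 ?(ltW m0R).
have h0 : 0 <= (L * D * m%:R) / 2 by rewrite mulr_ge0.
rewrite ler_wpM2l//.
rewrite -[leLHS](powR_root p0 h0).
rewrite ge0_ler_powR ?divr_ge0 ?(ltW p0)// ?nnegrE ?powR_ge0//.
  by rewrite mulr_ge0 ?Rintegral_ge0// => s _; exact: growth_ge0.
have h : m%:R * (L * D * m%:R) `^ p <=
    \int[mu]_(s in `[1, m.*2%:R]) (expR (L * D * s) - 1) `^ p.
  have := @Rintegral_homo_ge _ _ (growth_ge0 p (L * D))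
    (measurable_growth p (L * D)) (growth_homo (ltW p0) LD0)
    1 m%:R m.*2%:R ler01.
  rewrite ler1n ler_nat -addnn leq_addr natrD addrK => /(_ m0 isT).
  apply: le_trans; rewrite ler_wpM2l ?(ltW m0R)//.
  rewrite /growth ge0_ler_powR ?(ltW p0)// ?nnegrE//.
    by rewrite subr_ge0 -[leLHS]expR0 ler_expR.
  by rewrite lerBrDl expR_ge1Dx.
apply: (@le_trans _ _ (m.*2%:R^-1 * (m%:R * (L * D * m%:R) `^ p))); last first.
  by rewrite ler_wpM2l// invr_ge0.
rewrite mulrA -muln2 natrM invfM.
rewrite [X in _ <= X * _]mulrAC mulVf ?mul1r ?lt0r_neq0//.
rewrite powRM// mulrC ler_wpM2r ?powR_ge0//.
by apply: ge1r_powR => //; rewrite invr_gt0 ltr0n invf_le1 ?ltr0n// ler1n.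
Qed.

End Growth.

(** * The set of admissible horizons *)

Section AdmissibleHorizons.
Context {R : realType}.
Implicit Types (p q Cbar Kf L D : R).

Lemma nat_maxP (A : set nat) (M : nat) :
  A !=set0 -> (forall n, A n -> (n <= M)%N) ->
  A (nat_max A) /\ forall n, A n -> (n <= nat_max A)%N.
Proof.
move=> A0 AM.
suff : [set m | A m /\ forall n, A n -> (n <= m)%N] (nat_max A) by [].
apply: (@xgetPex _ 0%N).
have exA : exists n, `[< A n >] by case: A0 => n An; exists n; exact/asboolP.
have ubA n : `[< A n >] -> (n <= M)%N by move=> /asboolP; exact: AM.
case: (ex_maxnP exA ubA) => m /asboolP Am mmax.
by exists m; split=> // n An; apply: mmax; exact/asboolP.
Qed.

Lemma two_powRN_lt1 q : 0 < q -> 2 `^ (- q) < 1 :> R.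
Proof.
move=> q0; rewrite powRN invf_lt1 ?powR_gt0//.
rewrite -[X in X < _](congr1 (@^~ q) (powR1 R)).
by rewrite gt0_ltr_powR ?nnegrE ?ltr1n.
Qed.

Lemma Nset_threshold_gt0 pbar Cbar Kf L : 0 < pbar -> 0 < Cbar -> 0 < Kf ->
  0 < L -> 0 < ln (1 + Cbar * (1 - 2 `^ (- (1 / pbar))) / Kf) / (2 * L).
Proof.
move=> pb0 C0 K0 L0; rewrite divr_gt0 ?mulr_gt0// ln_gt0// ltrDl.
by rewrite divr_gt0// mulr_gt0// subr_gt0 two_powRN_lt1 ?divr_gt0.
Qed.

(** Since [epsbar] vanishes at 1, the condition at k = 1 only bounds its value
    at 2; the threshold on D is what [epsbar2_le] gives when solved for D. *)
Lemma Nset1 p pbar Cbar Kf L D : 1 <= p -> 0 < pbar -> 0 < Cbar -> 0 < Kf ->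
  0 < L -> 0 < D ->
  D < ln (1 + Cbar * (1 - 2 `^ (- (1 / pbar))) / Kf) / (2 * L) ->
  Nset p pbar Cbar Kf L D 1%N.
Proof.
move=> p1 pb0 C0 K0 L0 D0; rewrite ltr_pdivlMr ?mulr_gt0// => DD.
have p0 : p != 0 by rewrite lt0r_neq0// (lt_le_trans _ p1).
have gap : 0 < 1 - 2 `^ (- (1 / pbar)) :> R.
  by rewrite subr_gt0 two_powRN_lt1 ?divr_gt0.
split=> // k /andP[k1 kle].
have -> : k = 1%N by apply/eqP; rewrite eqn_leq k1 kle.
rewrite epsbar1// subr0 powR1.
have LD0 : 0 <= L * D by rewrite mulr_ge0 ?ltW.
apply: le_lt_trans (epsbar2_le p1 (ltW K0) LD0) _.
rewrite mulrC -ltr_pdivlMr// ltrBlDl.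
rewrite -ltr_expR lnK in DD; last first.
  by rewrite posrE addr_gt0// divr_gt0// mulr_gt0.
by apply: le_lt_trans DD; rewrite ler_expR [leRHS]mulrCA [leLHS]mulrC (mulrC L).
Qed.

Lemma telescope_le (u v : nat -> R) Cbar (N n : nat) :
  (forall k, (1 <= k <= N)%N -> u k.+1 - u k <= Cbar * (v k - v k.+1)) ->
  (0 < n)%N -> (n <= N)%N -> u n - u 1%N <= Cbar * (v 1%N - v n).
Proof.
move=> uv; case: n => // n _; elim: n => [|n IH] nN.
  by rewrite !subrr mulr0.
rewrite -[leLHS](subrKA (u n.+1)) -[v 1%N - _](subrKA (v n.+1)) mulrDr.
by rewrite [leRHS]addrC; apply: (lerD (uv n.+1 _) (IH _)); exact: ltnW nN.
Qed.

(** Summing the defining inequalities keeps [epsbar] below Cbar at every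
    admissible index, while [epsbar_double_ge] makes it exceed Cbar at an
    explicit even index. *)
Lemma Nset_bounded p pbar Cbar Kf L D : 1 <= p -> 0 < Cbar -> 0 < Kf ->
  0 < L -> 0 < D ->
  exists M : nat, forall N, Nset p pbar Cbar Kf L D N -> (N <= M)%N.
Proof.
move=> p1 C0 K0 L0 D0.
have p0 : p != 0 by rewrite lt0r_neq0// (lt_le_trans _ p1).
have a0 : 0 < Kf * (L * D) / 2 by rewrite divr_gt0 ?mulr_gt0.
(* Kf * L * D / 2 * m > Cbar, and 2 m > 0 because of the successor *)
pose m := (Num.bound (Cbar / (Kf * (L * D) / 2))).+1.
exists m.*2 => N [N0 HN]; rewrite leqNgt; apply/negP => mN.
have tele n : (0 < n)%N -> (n <= N)%N ->
    epsbar p Kf L D n <= Cbar * (1 - n%:R `^ (- (1 / pbar))).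
  move=> n0 nN; have := telescope_le (fun k kN => ltW (HN k kN)) n0 nN.
  by rewrite epsbar1// subr0 powR1.
have := tele m.*2 isT (ltnW mN); apply/negP; rewrite -ltNge.
apply: lt_le_trans (epsbar_double_ge p1 (ltW K0) _ _) => //; last first.
  by rewrite mulr_ge0 ?ltW.
apply: (@lt_trans _ _ Cbar).
  by rewrite gtr_pMr// gtrBl powR_gt0// ltr0n.
rewrite mulrA mulrA [X in _ < X]mulrAC mulrC -ltr_pdivrMr//.
apply: (lt_trans (archi_boundP _)); first by rewrite divr_ge0 ?ltW.
by rewrite ltr_nat.
Qed.

(** Both branches are one formula: p > d / 2 is also the condition under which
    the maximum of 2 * p and d is 2 * p. *)
Lemma nominal_radiusE (d : nat) p C c beta rho (N : nat) :
  0 < p -> p <> d%:R / 2 ->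
  nominal_radius d p C c beta rho N =
  (ln (C * beta^-1) / c) `^ (1 / Num.max (2 * p) d%:R) * rho
    * N%:R `^ (- (1 / Num.max (2 * p) d%:R)) :> R.
Proof.
move=> p0 pd; rewrite /nominal_radius powRN.
case: ltP => [dp|pd'].
  by rewrite max_l ?mulrA// ltW// mulrC -ltr_pdivrMr.
by rewrite max_r ?mulrA// mulrC -ler_pdivlMr.
Qed.

End AdmissibleHorizons.

(** * Independent fair coin tosses from binary digits *)

Section FairCoin.
Context {R : realType}.
Notation P := (uniform_prob (@ltr01 R)).

Lemma uniform_prob01_itv (a b : R) : 0 <= a -> a <= b -> b <= 1 ->
  P `[a, b[ = (b - a)%:E.
Proof.
move=> a0 ab b1; rewrite /uniform_prob integral_uniform_pdf.
have sub : `[a, b[%classic `<=` (`[0, 1]%classic : set R).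
  move=> x /=; rewrite !in_itv/= => /andP[ax xb].
  by rewrite (le_trans a0 ax) (le_trans (ltW xb) b1).
rewrite setIidl// (eq_integral (fun=> 1%E)); last first.
  move=> x; rewrite inE => /sub /=; rewrite in_itv /uniform_pdf /= => ->.
  by rewrite subr0 invr1.
rewrite integral_cst//= mul1e lebesgue_measure_itv/=; case: ifPn => //.
rewrite lte_fin -leNgt => ba; have -> : a = b by apply/eqP; rewrite eq_le ab.
by rewrite subrr.
Qed.

Definition dyadic (m k : nat) : set R :=
  `[k%:R / 2 ^+ m, k.+1%:R / 2 ^+ m[%classic.

Lemma measurable_dyadic m k : measurable (dyadic m k).
Proof. exact: measurable_itv. Qed.

Lemma uniform_prob_dyadic m k : (k < 2 ^ m)%N ->
  P (dyadic m k) = (2 ^- m)%:E.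
Proof.
move=> km; have p2 : 0 < 2 ^+ m :> R by exact: exprn_gt0.
rewrite uniform_prob01_itv ?divr_ge0 ?(ltW p2)//.
- by rewrite -mulrBl -natrB// subSnn mul1r.
- by rewrite ler_pM2r ?invr_gt0// ler_nat.
- by rewrite ler_pdivrMr// mul1r -natrX ler_nat.
Qed.

Lemma dyadic_halves m k :
  dyadic m k = dyadic m.+1 k.*2 `|` dyadic m.+1 k.*2.+1.
Proof.
have half j : j.*2%:R / 2 ^+ m.+1 = j%:R / 2 ^+ m :> R.
  by rewrite -muln2 natrM exprS invfM mulrA -(mulrA j%:R) mulfV ?mulr1.
rewrite /dyadic !half -[k.*2.+2]/(k.+1.*2) half -itv_bndbnd_setU// bnd_simp.
  by rewrite -half ler_pM2r ?invr_gt0 ?exprn_gt0// ler_nat.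
by rewrite -[leRHS]half ler_pM2r ?invr_gt0 ?exprn_gt0// ler_nat doubleS.
Qed.

Lemma dyadic_inj m k l x : dyadic m k x -> dyadic m l x -> k = l.
Proof.
have p2 : 0 < (2 ^+ m)^-1 :> R by rewrite invr_gt0 exprn_gt0.
rewrite /dyadic/= !in_itv/= => /andP[kx xk] /andP[lx xl].
have := le_lt_trans kx xl; have := le_lt_trans lx xk.
by rewrite !ltr_pM2r// !ltr_nat !ltnS => lk kl; apply/eqP; rewrite eqn_leq kl.
Qed.

(** The points of [0, +oo[ whose (m+1)-st binary digit after the point is 1: the
    right halves of the dyadic intervals of level m. *)
Definition heads (m : nat) : set R := \bigcup_k dyadic m.+1 k.*2.+1.

Lemma measurable_heads m : measurable (heads m).
Proof. by apply: bigcupT_measurable => k; exact: measurable_dyadic. Qed.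

Lemma headsP m k x : dyadic m.+1 k x -> heads m x <-> odd k.
Proof.
move=> kx; split=> [[j _ /(dyadic_inj kx)->]|ok]; first by rewrite /= odd_double.
exists k./2 => //.
by rewrite -[k./2.*2.+1]/(true + k./2.*2)%N -ok odd_double_half.
Qed.

Context {d : measure_display} {E : measurableType d}.
Context (tail head : E).

Definition toss (m : nat) (w : measurableTypeR R) : E :=
  if w \in heads m then head else tail.

Lemma measurable_toss m : measurable_fun setT (toss m).
Proof.
apply: measurable_fun_ifT => //; apply: (measurable_fun_bool true).
rewrite setTI (_ : _ @^-1` _ = heads m); first exact: measurable_heads.
by apply/seteqP; split=> [x /set_mem|x /mem_set].
Qed.

(** The mass given to A by the law of one toss. *)
Definition toss_weight (A : set E) : R :=
  ((tail \in A)%:R + (head \in A)%:R) / 2.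

Lemma toss_weightT : toss_weight setT = 1.
Proof. by rewrite /toss_weight !in_setT -natrD mulfV// pnatr_eq0. Qed.

Definition toss_event (A : nat -> set E) (m n : nat) : set R :=
  [set w | forall i, (m <= i < m + n)%N -> A i (toss i w)].

Lemma toss_event0 A m : toss_event A m 0 = setT.
Proof.
apply/seteqP; split=> // w _ i; rewrite addn0 => /andP[mi /(leq_ltn_trans mi)].
by rewrite ltnn.
Qed.

Lemma toss_eventS A m n :
  toss_event A m n.+1 = toss m @^-1` A m `&` toss_event A m.+1 n.
Proof.
apply/seteqP; split=> w /=.
  move=> H; split; first by apply: H; rewrite leqnn addnS leq_addr.
  by move=> i /andP[mi im]; apply: H; rewrite ltnW// addnS.
move=> [H0 H] i /andP[]; rewrite leq_eqVlt => /predU1P[<-//|mi im].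
by apply: H; rewrite mi addSn -addnS.
Qed.

Lemma measurable_toss_event A m n : (forall i, measurable (A i)) ->
  measurable (toss_event A m n).
Proof.
move=> mA; elim: n m => [|n IH] m; first by rewrite toss_event0.
rewrite toss_eventS; apply: measurableI => //.
by rewrite -[X in measurable X]setTI; exact: measurable_toss.
Qed.

(** Independence by refinement: within a dyadic interval of level m, the toss
    number m is constant on each of the two halves, so that conditioning on it
    reduces the claim to the two intervals of level m.+1 with one toss less. *)
Lemma uniform_prob_dyadic_toss A m n k : (forall i, measurable (A i)) ->
  (k < 2 ^ m)%N ->
  P (dyadic m k `&` toss_event A m n) =
    (2 ^- m * \prod_(m <= i < m + n) toss_weight (A i))%:E.
Proof.
move=> mA; elim: n m k => [|n IH] m k km.
  by rewrite addn0 big_geq// mulr1 -(uniform_prob_dyadic km) toss_event0 setIT.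
rewrite dyadic_halves toss_eventS setIUl.
have half (j : nat) : (j < 2 ^ m.+1)%N ->
  P (dyadic m.+1 j `&` (toss m @^-1` A m `&` toss_event A m.+1 n)) =
  (((if odd j then head else tail) \in A m)%:R *
   (2 ^- m.+1 * \prod_(m.+1 <= i < m.+1 + n) toss_weight (A i)))%:E.
  move=> jm; have tj x : dyadic m.+1 j x ->
    toss m x = if odd j then head else tail.
    move=> /headsP h; rewrite /toss; case: ifPn => [/set_mem/h->//|].
    by case: ifPn => // /h /mem_set ->.
  move: tj; set v := (if odd j then _ else _) => tj.
  case: (boolP (v \in A m)) => [/set_mem Av|/negP Av].
    rewrite mul1r -(IH m.+1 j jm); congr (P _); apply/seteqP; split=> x [jx].
      by move=> [].
    by move=> ?; split=> //; split=> //=; rewrite tj.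
  rewrite mul0r (_ : _ `&` _ = set0) ?measure0//.
  apply/seteqP; split=> // x [jx [/= Ax _]]; apply: Av.
  by rewrite in_setE -(tj _ jx).
have mS : measurable (toss m @^-1` A m `&` toss_event A m.+1 n).
  by rewrite -toss_eventS; exact: measurable_toss_event.
set S := _ `&` toss_event A m.+1 n in half mS *.
transitivity (P (dyadic m.+1 k.*2 `&` S) + P (dyadic m.+1 k.*2.+1 `&` S))%E.
  apply: measureU.
  - by apply: measurableI => //; exact: measurable_dyadic.
  - by apply: measurableI => //; exact: measurable_dyadic.
  - apply/seteqP; split=> // x [[] /dyadic_inj inj _ [] /inj + _].
    by move=> /(congr1 odd); rewrite /= odd_double.
rewrite !half ?expnS ?mul2n ?ltn_Sdouble ?ltn_double//.
rewrite /= odd_double/= -EFinD; congr (_%:E).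
rewrite -mulrDl addnS big_nat_recl; last by rewrite leq_addr.
by rewrite [in RHS]mulrCA exprS invfM big_add1/= /toss_weight -!mulrA.
Qed.

(** The interval [0, 1[ carries all the mass, and is dyadic of level 0. *)
Lemma uniform_prob_toss A n : (forall i, measurable (A i)) ->
  P (toss_event A 0 n) = (\prod_(0 <= i < n) toss_weight (A i))%:E.
Proof.
move=> mA; have := @uniform_prob_dyadic_toss A 0 n 0 mA isT.
rewrite expr0 invr1 mul1r add0n => <-.
have mD : measurable (dyadic 0 0) by exact: measurable_dyadic.
have D1 : P (dyadic 0 0) = 1%E by rewrite uniform_prob_dyadic// expr0 invr1.
have mS := @measurable_toss_event A 0 n mA.
rewrite setIC -[in LHS](setIT (toss_event _ _ _)) -(setUv (dyadic 0 0)) setIUr.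
rewrite measureU; last 3 first.
- exact: measurableI.
- by apply: measurableI => //; exact: measurableC.
- by apply/seteqP; split=> // x [[_ ?] [_ ?]].
rewrite [X in (_ + X)%E](_ : _ = 0%E) ?adde0//.
apply: (@subset_measure0 _ _ _ P _ (~` dyadic 0 0)) => //.
- by apply: measurableI => //; exact: measurableC.
- exact: measurableC.
transitivity (1 - P (dyadic 0 0))%E; first exact: probability_setC.
by rewrite D1 subee.
Qed.

(** An arbitrary finite set of indices is completed to an initial segment by
    imposing the full event at the missing indices. *)
Lemma uniform_prob_toss_seq A (s : seq nat) : uniq s ->
  (forall i, measurable (A i)) ->
  P (\bigcap_(i in [set` s]) (toss i @^-1` A i)) =
    (\prod_(i <- s) toss_weight (A i))%:E.
Proof.
move=> us mA; pose A' i := if i \in s then A i else setT.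
pose n := (\max_(i <- s) i).+1.
have sn i : i \in s -> (i < n)%N.
  by move=> si; rewrite ltnS; exact: (@leq_bigmax_seq _ s xpredT id i).
have mA' i : measurable (A' i) by rewrite /A'; case: ifP.
rewrite (_ : \bigcap_(_ in _) _ = toss_event A' 0 n); last first.
  apply/seteqP; split=> w H i.
    by move=> _; rewrite /A'; case: ifPn => // si; exact: (H i).
  by move=> /= si; have := H i; rewrite /A' si; apply; rewrite add0n sn.
rewrite uniform_prob_toss//; congr (_%:E).
rewrite (bigID (mem s))/= [X in _ * X]big1 ?mulr1; last first.
  by move=> i /negbTE si; rewrite /A' si toss_weightT.
rewrite -big_filter (perm_big s); last first.
  apply: uniq_perm => //; first by rewrite filter_uniq// iota_uniq.
  move=> i; rewrite mem_filter mem_index_iota leq0n /=.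
  by case: (boolP (i \in s)) => //= /sn ->.
by apply: eq_big_seq => i si; rewrite /A' si.
Qed.

Lemma uniform_prob_toss1 i (B : set E) : measurable B ->
  P (toss i @^-1` B) = (toss_weight B)%:E.
Proof.
move=> mB; have := @uniform_prob_toss_seq (fun=> B) [:: i] isT (fun=> mB).
rewrite big_seq1 => <-; congr (P _); apply/seteqP; split=> w.
  by move=> Bw j /=; rewrite inE => /eqP ->.
by move=> /(_ i); apply; rewrite /= inE.
Qed.

End FairCoin.

(** * A lower bound on the distance to a Dirac mass *)

Section Wasserstein.
Context {R : realType} {d : nat}.
Notation E := (borelRd R d).

(** Both sides are suprema over the nonnegative simple functions below the
    integrand, whatever the integrand; this form applies as it stands to the
    transport cost. *)
Lemma ge0_le_integralT d' (T : measurableType d')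
  (mu : {measure set T -> \bar R}) (f g : T -> \bar R) : (forall x, 0 <= f x)%E -> (forall x, f x <= g x)%E ->
  (\int[mu]_x f x <= \int[mu]_x g x)%E.
Proof.
move=> f0 fg; have g0 x := le_trans (f0 x) (fg x).
rewrite !ge0_integralTE//; apply: le_ereal_sup => _ [h /= hf <-].
by exists h => //= x; exact: le_trans (fg x).
Qed.

Lemma measurable_borelRd_set1 (x : 'rV[R]_d) : measurable ([set x] : set E).
Proof.
rewrite -[X in measurable X]setCK; apply: measurableC.
apply: sub_sigma_algebra; apply: closed_openC.
apply: accessible_closed_set1; apply: hausdorff_accessible.
exact: norm_hausdorff.
Qed.

(** Any coupling of the Dirac mass at x with nu gives mass nu {y} to the point
    (x, y), hence costs at least that mass times |x - y|^p. *)
Lemma wasserstein_dirac_ge (p : R) (nu : set E -> \bar R) (x y : 'rV[R]_d) :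
  p != 0 ->
  (((enorm (x - y)) `^ p)%:E * nu [set y] <=
    poweR (wasserstein p (\d_(x : E)) nu) p)%E.
Proof.
move=> p0; rewrite /wasserstein -poweRrM mulVf// poweRe1; last first.
  apply: le_ereal_inf_tmp => _ [pi _ <-].
  by apply: integral_ge0 => z _; rewrite lee_fin powR_ge0.
apply: le_ereal_inf_tmp => _ [pi cpi <-].
have mx := measurable_borelRd_set1 x; have my := measurable_borelRd_set1 y.
have mS : measurable ([set (x : E)] `*` [set (y : E)]) by exact: measurableX.
have -> : nu [set y] = pi ([set (x : E)] `*` [set (y : E)]).
  have mC : measurable (~` [set (x : E)] `*` [set (y : E)]).
    by apply: measurableX => //; exact: measurableC.
  have <- := (cpi [set y] my).2.
  rewrite (_ : setT `*` _ = ([set (x : E)] `*` [set (y : E)]) `|`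
      (~` [set (x : E)] `*` [set (y : E)])); last first.
    apply/seteqP; split=> [[u v] [_ vy]|[u v] [] [? ?]]//.
    by have [ux|ux] := pselect (u = x); [left|right].
  rewrite measureU//; last first.
    by apply/seteqP; split=> // -[u v] [[/= ? _] [/= ? _]].
  (* the first marginal of pi does not charge the complement of x *)
  rewrite [X in (_ + X)%E](_ : _ = 0%E) ?adde0//.
  apply: (@subset_measure0 _ _ _ pi _ (~` [set (x : E)] `*` setT)) => //.
  - by apply: measurableX => //; exact: measurableC.
  - by move=> [u v] [].
  have := (cpi _ (measurableC mx)).1.
  by rewrite diracE memNset//= => /(_ erefl).
set S := [set _] `*` [set _] in mS *; set r : R := enorm (x - y) `^ p.
have <- : (\int[pi]_(z in S) r%:E = r%:E * pi S)%E by exact: integral_cst.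
rewrite integral_mkcond; apply: ge0_le_integralT.
  by move=> z; rewrite patchE; case: ifP => // _; rewrite lee_fin powR_ge0.
move=> [u v]; rewrite patchE; case: ifPn; last by rewrite lee_fin powR_ge0.
by rewrite inE => -[/= -> ->].
Qed.

End Wasserstein.

(** * Concentration constants are at least 1 *)

Section ConcentrationConstants.
Context {R : realType} {d : nat}.
Notation E := (borelRd R d).

Lemma diam_ge0 (S : set 'rV[R]_d) : 0 <= diam S.
Proof.
rewrite /diam; set D := (X in sup X).
have [[[r Dr] ubD]|/sup_out->//] := pselect (has_sup D).
have /= := ub_le_sup ubD Dr.
by apply: le_trans; case: Dr => x [y [_ _ ->]].
Qed.

Lemma enorm_const1_ge1 : (0 < d)%N -> 1 <= enorm (const_mx 1 : 'rV[R]_d).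
Proof.
move=> d0; rewrite /enorm -[leLHS]sqrtr1 ler_wsqrtr//.
rewrite (eq_bigr (fun=> 1)); last by move=> i _; rewrite mxE expr1n.
by rewrite big_const_ord iter_addr addr0 ler1n.
Qed.

Definition uniform01 : probability (measurableTypeR R) R :=
  uniform_prob (@ltr01 R).
Notation P := uniform01.
Notation o := (0 : 'rV[R]_d).
Notation e := (const_mx 1 : 'rV[R]_d).
Definition fair_tosses (m : nat) : {RV P >-> E} := 
  mfun_Sub (mem_set (measurable_toss (o : E) (e : E) m)).
Notation X := fair_tosses.

Lemma fair_tosses_prob (i : nat) (A : set E) : measurable A ->
  P (X i @^-1` A) = (toss_weight (o : E) (e : E) A)%:E.
Proof. exact: uniform_prob_toss1. Qed.

Lemma iid_fair_tosses : iid X.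
Proof.
split=> [s A us mA|i j A mA].
  under [RHS]eq_bigr do rewrite fair_tosses_prob//.
  by rewrite prodEFin; exact: uniform_prob_toss_seq.
by rewrite !fair_tosses_prob.
Qed.

Lemma toss_weight_ge_half (x : 'rV[R]_d) : x = o \/ x = e ->
  1 / 2 <= @toss_weight R _ E o e [set x].
Proof.
rewrite /toss_weight => -[] ->; rewrite ler_pM2r ?invr_gt0//.
  by rewrite (mem_set (erefl : [set o] o)) lerDl.
by rewrite (mem_set (erefl : [set e] e)) lerDr.
Qed.

(** The complement of the two values is an open set of measure zero, so the
    support is finite. *)
Lemma compact_msupport_fair_tosses :
  compact (msupport (distribution P (X 0%N))).
Proof.
apply: finite_compact; apply: (@sub_finite_set _ _ [set o; e]) => //.
move=> x sx; apply: contrapT => xoe.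
have cl : closed [set o; e].
  apply: accessible_finite_set_closed.1; last exact: finite_set2.
  by apply: hausdorff_accessible; exact: norm_hausdorff.
have := sx _ (closed_openC cl) xoe.
rewrite /distribution /pushforward fair_tosses_prob; last first.
  by apply: sub_sigma_algebra; exact: closed_openC.
rewrite /toss_weight !memNset ?addr0 ?mul0r ?ltxx//=.
- by apply; right.
- by apply; left.
Qed.

(** The empirical measure of one toss is a Dirac mass at one of the two values,
    and the other value has mass at least 1/2 and lies at distance at least 1. *)
Lemma wasserstein_fair_tosses_ge (p : R) (w : R) : 1 <= p -> (0 < d)%N ->
  ((1 / 2)%:E <= poweR (wasserstein p (empirical X 1 w)
                          (distribution P (X 0%N))) p)%E.
Proof.
move=> p1 d0; have p0 : p != 0 by rewrite lt0r_neq0// (lt_le_trans _ p1).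
have -> : empirical X 1 w = \d_(X 0%N w).
  by apply/funext => A; rewrite /empirical big_ord1 invr1 mul1e.
have [y yoe dist] : exists2 y : 'rV[R]_d, y = o \/ y = e &
    1 <= enorm ((X 0%N w : 'rV[R]_d) - y).
  rewrite /fair_tosses/= /toss; case: ifP => _.
    by exists o; [left|rewrite subr0 enorm_const1_ge1].
  exists e; first by right.
  rewrite (_ : enorm (o - e) = enorm e) ?enorm_const1_ge1//.
  rewrite /enorm; congr Num.sqrt; apply: eq_bigr => i _.
  by rewrite !mxE sub0r sqrrN.
apply: le_trans (wasserstein_dirac_ge _ _ y p0).
rewrite /distribution /pushforward fair_tosses_prob; last first.
  exact: measurable_borelRd_set1.
rewrite -EFinM lee_fin -[leLHS]mul1r ler_pM ?toss_weight_ge_half//.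
by rewrite (le_trans dist)// le1r_powR.
Qed.

(** For one fair toss and eps = 1/2 the event of the concentration inequality is
    the whole space, while the exponential factor is at most 1. *)
Lemma concentration_constants_ge1 (p C c : R) : (0 < d)%N -> 1 <= p ->
  p <> d%:R / 2 -> 0 < c -> concentration_constants d p C c -> 1 <= C.
Proof.
move=> d0 p1 pd c0 /(_ _ _ P X iid_fair_tosses compact_msupport_fair_tosses 1%N
  (1 / 2) isT).
have half0 : 0 < 1 / 2 :> R by rewrite divr_gt0.
move=> /(_ half0); rewrite (_ : [set w | _] = setT); last first.
  by apply/seteqP; split=> // w _; exact: wasserstein_fair_tosses_ge.
have -> : P setT = 1%E by exact: probability_setT.
set r := diam _ / 2; have r0 : 0 <= r by rewrite divr_ge0// diam_ge0.
have bound (u : R) : 0 <= u -> (1 <= (C * expR (- u))%:E)%E -> 1 <= C.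
  move=> u0; rewrite lee_fin expRN -[C * _]/(C / _) ler_pdivlMr ?expR_gt0// mul1r.
  by apply: le_trans; rewrite -[leLHS]expR0 ler_expR.
move=> [big small]; have [dp|pd'] := ltP (d%:R / 2) p.
  apply: bound (big dp); rewrite divr_ge0 ?powR_ge0//.
  by rewrite !mulr_ge0 ?exprn_ge0 ?ltW.
have lpd : p < d%:R / 2 by rewrite lt_neqAle pd' andbT; exact/eqP.
by apply: bound (small lpd); rewrite divr_ge0 ?exprn_ge0// !mulr_ge0 ?powR_ge0 ?ltW.
Qed.

End ConcentrationConstants.

(** * Monotonicity of the ambiguity radius *)

Theorem mainTheorem3 (R : realType) (d : nat) (p : R)
  (hd : (0 < d)%N) (hp : 1 <= p) (hpd : p <> d%:R / 2) :
  (* Dstar is a function of Cbar, L and Kf only (p and d being fixed) *)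
  exists Dstar : R -> R -> R -> R,
  forall (F : R -> 'rV[R]_d -> 'rV[R]_d)
    (K : set 'rV[R]_d) (mu0 : probability (borelRd R d) R) (T : R)
    (Phinum : R -> R -> 'rV[R]_d -> 'rV[R]_d) (Kf L : R) (C c beta : R),
  continuous_field F -> locally_lipschitz_field F -> forward_complete F ->
  compact K -> msupport mu0 `<=` K -> 0 <= T ->
  0 < Kf -> 0 < L ->
  (forall (s t : R) (x : 'rV[R]_d), 0 <= s -> s <= t -> t <= T ->
    (flow F s 0 @` K) x ->
    enorm (Phinum t s x - flow F t s x) <= Kf * (expR (L * (t - s)) - 1)) ->
  0 < c -> concentration_constants d p C c ->
  0 < beta < 1 ->
  let rhoT := diam (flow F T 0 @` K) / 2 in
  0 < rhoT ->
  let pbar := Num.max (2 * p) d%:R in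
  let Cbar := (ln (C * beta^-1) / c) `^ (1 / pbar) * rhoT in
  0 < Dstar Cbar L Kf /\
  forall Delta : R, 0 < Delta < Dstar Cbar L Kf ->
    let NDelta := Nset p pbar Cbar Kf L Delta in
    [/\ NDelta !=set0,
        exists M : nat, forall N : nat, NDelta N -> (N <= M)%N &
        let Nstar := (nat_max NDelta).+1 in
        forall N M : nat, (1 <= N)%N -> (N < M)%N -> (M <= Nstar)%N ->
          psi d p C c beta rhoT Kf L Delta M <
          psi d p C c beta rhoT Kf L Delta N].
Proof.
have p0 : 0 < p by exact: lt_le_trans hp.
have pbar0 : 0 < Num.max (2 * p) d%:R by rewrite lt_max mulr_gt0.
exists (fun Cb L Kf =>
  ln (1 + Cb * (1 - 2 `^ (- (1 / Num.max (2 * p) d%:R))) / Kf) / (2 * L)).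
move=> F K mu0 T Phinum Kf L C c beta _ _ _ _ _ _ K0 L0 _ c0 hC
  /andP[beta0 beta1] rhoT rhoT0 pbar Cbar.
have C1 : 1 <= C by exact: concentration_constants_ge1 hC.
have Cbar0 : 0 < Cbar.
  rewrite mulr_gt0// powR_gt0// divr_gt0// ln_gt0// ltr_pdivlMr// mul1r.
  exact: lt_le_trans C1.
split; first exact: Nset_threshold_gt0.
move=> D /andP[D0 DD] NDelta.
have N1 : NDelta 1%N by exact: Nset1.
have [M NM] : exists M : nat, forall N : nat, NDelta N -> (N <= M)%N.
  exact: Nset_bounded.
split; [by exists 1%N | by exists M |].
have [[_ Hmax] _] := nat_maxP (ex_intro _ _ N1) NM.
have step k : (0 < k)%N -> (k <= nat_max NDelta)%N ->
    psi d p C c beta rhoT Kf L D k.+1 < psi d p C c beta rhoT Kf L D k.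
  move=> k0 kn; have := Hmax k; rewrite k0 kn => /(_ isT).
  rewrite /psi !nominal_radiusE// -/pbar -/Cbar mulrBr ltrBlDr.
  by rewrite addrAC ltrBrDl.
move=> Nstar N N' N0; elim: N' => // N' IH; rewrite ltnS leq_eqVlt.
move=> /predU1P[<-|NN'] N's; first exact: step.
apply: lt_trans (IH NN' (ltnW N's)); apply: step => //.
exact: leq_trans NN'.
Qed.
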